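(* Let $\mathbf W$ be a real linear space with a scalar product $\langle\cdot,\cdot\rangle$. Let $K\le M$, and let $\mathbf U$ and $\mathbf V$ be subspaces of $\mathbf W$ of dimensions $K$ and $M$, respectively. Then there exist an orthonormal basis $\mathbf u_1,\dots,\mathbf u_K$ of $\mathbf U$, an orthonormal basis $\mathbf v_1,\dots,\mathbf v_M$ of $\mathbf V$, and real numbers $1\ge c_1\ge c_2\ge\dots\ge c_K\ge 0$ such that $$\langle \mathbf u_i,\mathbf u_j\rangle=\delta_{i=j}\ (1\le i,j\le K),\qquad \langle \mathbf v_i,\mathbf v_j\rangle=\delta_{i=j}\ (1\le i,j\le M),\qquad \langle \mathbf u_i,\mathbf v_j\rangle=c_i\,\delta_{i=j}\ (1\le i\le K,\ 1\le j\le M).$$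
   Context: $\delta_{i=j}$ equals $1$ if $i=j$ and $0$ otherwise. All vector spaces are real. *)

(* Defs.v *)
From mathcomp Require Import all_boot all_order all_algebra.
From mathcomp Require Import reals.

Set Implicit Arguments.
Unset Strict Implicit.
Unset Printing Implicit Defensive.

Import GRing.Theory.
Local Open Scope ring_scope.

(* The library's [free], [basis_of] and [\dim] require a finite-dimensional
   ambient space ([vectType]); the ambient space here is an arbitrary
   [lmodType], so these notions are given for finite families in it. *)

Definition lin_indep (R : realType) (W : lmodType R) (n : nat)
    (e : 'I_n -> W) : Prop :=
  forall a : 'I_n -> R, \sum_(i < n) a i *: e i = 0 -> forall i, a i = 0.

Definition is_basis (R : realType) (W : lmodType R) (U : submodClosed W)
    (n : nat) (e : 'I_n -> W) : Prop :=
  [/\ forall i, e i \in U,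
      lin_indep e
    & forall x, x \in U -> exists a : 'I_n -> R, x = \sum_(i < n) a i *: e i].

Definition has_dim (R : realType) (W : lmodType R) (U : submodClosed W)
    (n : nat) : Prop :=
  exists e : 'I_n -> W, is_basis U e.

(* Main.v *)
Require Import Defs.
From mathcomp Require Import all_boot all_order all_algebra.
From mathcomp Require Import reals.
From mathcomp Require boolp classical_sets topology normedtype derive.
From mathcomp Require Import ring lra.

(** In orthonormal bases of [U] and [V] the scalar product restricted to
    [U x V] is a real matrix, so the theorem is its singular value
    decomposition.  Let [s] be the maximum of the bilinear form [x A y^T] on
    pairs of unit vectors.  In orthonormal bases starting with a maximizing
    pair, the other entries of the first row and of the first column vanish by
    maximality; one continues with the remaining block, whose singular values
    are at most [s].  Cauchy-Schwarz bounds the singular values by [1]. *)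

Set Implicit Arguments.
Unset Strict Implicit.
Unset Printing Implicit Defensive.

Import Order.TTheory GRing.Theory Num.Theory.
Local Open Scope ring_scope.

(** * Maximizing a bilinear form over pairs of unit vectors *)

Section MaximalPair.
Import boolp classical_sets topology normedtype derive.
Import numFieldNormedType.Exports.
Local Open Scope classical_set_scope.
Variable R : realType.

Lemma continuous_bilinear m n (A : 'M[R]_(m, n)) :
  continuous (fun z : 'rV[R]_m * 'rV[R]_n => (z.1 *m A *m z.2^T) 0 0).
Proof.
have coord1 i : continuous (fun z : 'rV[R]_m * 'rV[R]_n => z.1 0 i).
  move=> z; apply: (@continuous_comp _ _ _ fst (fun x : 'rV[R]_m => x 0 i)).
    exact: cvg_fst.
  exact: coord_continuous.
have coord2 i : continuous (fun z : 'rV[R]_m * 'rV[R]_n => z.2 0 i).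
  move=> z; apply: (@continuous_comp _ _ _ snd (fun x : 'rV[R]_n => x 0 i)).
    exact: cvg_snd.
  exact: coord_continuous.
under eq_fun do rewrite mxE.
apply: continuous_big => [|j _]; first exact: add_continuous.
under eq_fun do rewrite !mxE.
move=> z; apply: continuousM; last exact: coord2.
move: z; apply: continuous_big => [|i _]; first exact: add_continuous.
by move=> z; apply: continuousM; [exact: coord1 | exact: cst_continuous].
Qed.

Lemma sqnorm_ge0 n (x : 'rV[R]_n) : 0 <= (x *m x^T) 0 0.
Proof. by rewrite mxE sumr_ge0// => i _; rewrite mxE -expr2 sqr_ge0. Qed.

Lemma sqnorm_eq0 n (x : 'rV[R]_n) : (x *m x^T) 0 0 = 0 -> x = 0.
Proof.
rewrite mxE => /eqP; rewrite psumr_eq0 => [/allP x0|i _]; last first.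
  by rewrite mxE -expr2 sqr_ge0.
apply/rowP => i; have := x0 i (mem_index_enum i).
by rewrite !mxE mulf_eq0 orbb => /eqP.
Qed.

(** The sphere is a closed subset of the compact cube with sides [[-1, 1]]. *)
Lemma compact_sphere n : compact [set x : 'rV[R]_n | (x *m x^T) 0 0 = 1].
Proof.
have cube : compact [set x : 'rV[R]_n | forall i, `[(-1 : R), 1] (x ord0 i)].
  apply: (@rV_compact _  _ (fun=> `[(-1 : R), 1])) => _.
  exact: segment_compact.
apply: subclosed_compact cube _.
  apply: (@preimage_closed _ _ (fun x : 'rV[R]_n => (x *m x^T) 0 0)
    (mkset (eq^~ (1 : R)))); last exact: closed_eq.
  move=> x _ /=.
  (* The squared norm is the bilinear form of [1%:M] restricted to the diagonal, so
     [continuous_bilinear] applies. *)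
  have -> : (fun x : 'rV[R]_n => (x *m x^T) 0 0) =
      (fun z : 'rV[R]_n * 'rV[R]_n => (z.1 *m 1%:M *m z.2^T) 0 0) \o
      (fun x => (x, x)) by apply/funext => y /=; rewrite mulmx1.
  apply: continuous_comp; last exact: continuous_bilinear.
  have Fx := nbhs_filter x.
  by apply: (cvg_pair (FF := Fx) (FG := Fx) (FH := Fx)) => P.
move=> x /= x1 i; rewrite in_itv /= -ler_norml.
rewrite -(@ler_pXn2r _ 2) ?nnegrE// expr1n real_normK ?num_real// -x1 mxE.
rewrite (bigD1 i)//= mxE -expr2 lerDl sumr_ge0// => j _.
by rewrite mxE -expr2 sqr_ge0.
Qed.

Lemma sphere_nonempty n : exists x : 'rV[R]_n.+1, (x *m x^T) 0 0 = 1.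
Proof.
exists (delta_mx 0 0); rewrite mxE (bigD1 0)//= big1 => [|i /negPf i0].
  by rewrite !mxE !eqxx mulr1 addr0.
by rewrite !mxE i0 mul0r.
Qed.

Lemma normalize n (x : 'rV[R]_n) : x != 0 ->
  exists2 y, (y *m y^T) 0 0 = 1 & x = Num.sqrt ((x *m x^T) 0 0) *: y.
Proof.
move=> x0; set q := (x *m x^T) 0 0.
have q0 : 0 < q.
  rewrite lt_neqAle sqnorm_ge0 andbT eq_sym.
  by apply: contra x0 => /eqP /sqnorm_eq0 ->.
have s0 : Num.sqrt q != 0 by rewrite gt_eqF ?sqrtr_gt0.
exists ((Num.sqrt q)^-1 *: x); last by rewrite scalerA divff// scale1r.
rewrite linearZ -scalemxAl -scalemxAr scalerA mxE -invfM -expr2.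
by rewrite sqr_sqrtr ?(ltW q0)// mulVf// gt_eqF.
Qed.

(** The maximum exists by compactness of the product of two spheres. The bound is squared and
    homogeneous, so that it can be tested on vectors that are not normalized. *)
Lemma max_bilinear m n (A : 'M[R]_(m.+1, n.+1)) :
  exists s (x : 'rV_m.+1) (y : 'rV_n.+1),
    [/\ 0 <= s, (x *m x^T) 0 0 = 1, (y *m y^T) 0 0 = 1,
        (x *m A *m y^T) 0 0 = s &
        forall (x' : 'rV_m.+1) (y' : 'rV_n.+1), ((x' *m A *m y'^T) 0 0) ^+ 2 <=
          s ^+ 2 * (x' *m x'^T) 0 0 * (y' *m y'^T) 0 0].
Proof.
pose f (z : 'rV[R]_m.+1 * 'rV[R]_n.+1) := (z.1 *m A *m z.2^T) 0 0.
have [[x y]] : exists2 z : 'rV[R]_m.+1 * 'rV[R]_n.+1,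
    z \in [set x : 'rV[R]_m.+1 | (x *m x^T) 0 0 = 1] `*`
          [set y : 'rV[R]_n.+1 | (y *m y^T) 0 0 = 1] &
    forall t, t \in [set x : 'rV[R]_m.+1 | (x *m x^T) 0 0 = 1] `*`
          [set y : 'rV[R]_n.+1 | (y *m y^T) 0 0 = 1] -> f t <= f z.
  apply: compact_EVT_max.
  - have [x x1] := sphere_nonempty m; have [y y1] := sphere_nonempty n.
    by exists (x, y).
  - by apply: compact_setX; exact: compact_sphere.
  - by apply: continuous_subspaceT; exact: continuous_bilinear.
rewrite inE => -[/= x1 y1] fmax.
have {}fmax (x' : 'rV_m.+1) (y' : 'rV_n.+1) :
    (x' *m x'^T) 0 0 = 1 -> (y' *m y'^T) 0 0 = 1 ->
    `|(x' *m A *m y'^T) 0 0| <= f (x, y).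
  move=> x'1 y'1; rewrite ler_norml; apply/andP; split.
    (* Changing the sign of [x'] turns the upper bound into the lower one; hence [s] bounds an
       absolute value and is nonnegative. *)
    have := fmax (- x', y'); rewrite /f /= !mulNmx mxE lerNl; apply.
    by rewrite inE; split; rewrite //= linearN mulNmx mulmxN opprK.
  by apply: (fmax (x', y')); rewrite inE; split.
have s0 : 0 <= f (x, y) by apply: le_trans (fmax x y x1 y1).
exists (f (x, y)), x, y; split=> // x' y'.
have [->|x'0] := eqVneq x' 0; first by rewrite !mul0mx mxE expr0n mulr0 mul0r.
have [->|y'0] := eqVneq y' 0.
  by rewrite linear0 !mulmx0 mxE expr0n mulr0.
have [x2 x21 ->] := normalize x'0; have [y2 y21 ->] := normalize y'0.
set a := Num.sqrt _; set b := Num.sqrt _.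
rewrite !linearZ /= -!scalemxAl !linearZ /=.
have entryZ c (B : 'M[R]_1) : (c *: B) 0 0 = c * B 0 0 by rewrite mxE.
rewrite !entryZ x21 y21.
have := fmax _ _ x21 y21; set t := (x2 *m A *m y2^T) 0 0 => ts.
have : t ^+ 2 <= f (x, y) ^+ 2.
  by rewrite -(real_normK (num_real t)) ler_pXn2r ?nnegrE.
move=> tf; rewrite !mulr1 mulrA exprMn.
have -> : f (x, y) ^+ 2 * (a * a) * (b * b) = (a * b) ^+ 2 * f (x, y) ^+ 2.
  by ring.
by rewrite ler_wpM2l ?sqr_ge0.
Qed.

End MaximalPair.

(** * Orthogonal matrices, singular values and positive definite matrices *)

Section RealMatrices.
Variable R : realType.

(* [P] is the Householder reflection exchanging the first basis vector and [x]. *)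
Lemma unit_row_completion n (x : 'rV[R]_(1 + n)) : (x *m x^T) 0 0 = 1 ->
  exists2 P : 'M[R]_(1 + n), P *m P^T = 1%:M & row 0 P = x.
Proof.
move=> x1; pose e : 'rV[R]_(1 + n) := delta_mx 0 0.
have [xe|xNe] := eqVneq x e.
  exists 1%:M; first by rewrite trmx1 mulmx1.
  by rewrite xe; apply/rowP => j; rewrite !mxE eqxx eq_sym.
pose w := x - e; pose q := (w *m w^T) 0 0.
have q0 : q != 0.
  by apply: contra xNe => /eqP /sqnorm_eq0 /eqP; rewrite subr_eq0.
have wwT : w *m w^T = q%:M by rewrite [LHS]mx11_scalar.
(* Since [x] and [e] are unit vectors, [q = |x - e|^2 = 2 (1 - <e, x>)], while
   [<e, w> = <e, x> - 1]. *)
have ewT : e *m w^T = (- (q / 2))%:M.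
  have xxT : x *m x^T = 1%:M by rewrite [LHS]mx11_scalar x1.
  have eeT : e *m e^T = 1%:M.
    by rewrite trmx_delta mul_delta_mx; apply/matrixP => i j; rewrite !ord1 !mxE.
  have xeT : x *m e^T = e *m x^T.
    by rewrite [LHS]mx11_scalar [RHS]mx11_scalar -[x *m e^T in LHS]trmxK
      trmx_mul trmxK mxE.
  have qE : q%:M = (1%:M - e *m x^T) *+ 2 :> 'M[R]_1.
    rewrite -wwT /w linearB /= mulmxBl !mulmxBr xxT eeT xeT mulr2n.
    by rewrite opprB addrACA.
  have -> : (- (q / 2))%:M = - (2^-1 *: q%:M) :> 'M[R]_1.
    by rewrite scale_scalar_mx raddfN /= mulrC.
  rewrite qE -scaler_nat scalerA mulVf ?scale1r ?pnatr_eq0//.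
  by rewrite /w linearB /= mulmxBr eeT opprB.
(* [w] is made opaque: [mulmxBr] would otherwise see through it *)
have wE : w = x - e by [].
move: (w) @q wE q0 wwT ewT => {}w q wE q0 wwT ewT.
pose P : 'M[R]_(1 + n) := 1%:M - (2 / q) *: (w^T *m w).
have PT : P^T = P by rewrite /P linearB linearZ /= trmx1 trmx_mul trmxK.
exists P.
  rewrite PT /P mulmxBl mul1mx mulmxBr mulmx1 -scalemxAl -scalemxAr scalerA.
  rewrite mulmxA -(mulmxA w^T w) wwT mul_mx_scalar -scalemxAl scalerA.
  have -> : 2 / q * (2 / q) * q = 2 / q *+ 2.
    by rewrite -mulrA divfK// mulr_natr.
  by rewrite -scalerMnl; set T := _ *: _; rewrite (mulr2n T) opprB addrK subrK.
(* The first row is [e P = e - (2 / q) <e, w> w = e + w = x]. *)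
rewrite rowE /P mulmxBr mulmx1 -scalemxAr mulmxA ewT mul_scalar_mx scalerA.
have -> : 2 / q * - (q / 2) = -1 by field; rewrite q0.
by rewrite scaleN1r opprK wE addrC subrK.
Qed.

Lemma orthogonal_block n (P : 'M[R]_n) : P *m P^T = 1%:M ->
  block_mx 1%:M 0 0 P *m (block_mx 1%:M 0 0 P)^T = 1%:M :> 'M[R]_(1 + n).
Proof.
move=> PPT; rewrite tr_block_mx mulmx_block !trmx0 !mulmx0 !mul0mx trmx1 mulmx1.
by rewrite !addr0 add0r PPT -scalar_mx_block.
Qed.

Lemma orthogonal_mul n (P Q : 'M[R]_n) : P *m P^T = 1%:M -> Q *m Q^T = 1%:M ->
  P *m Q *m (P *m Q)^T = 1%:M.
Proof.
by move=> PP QQ; rewrite trmx_mul mulmxA -(mulmxA P) QQ mulmx1.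
Qed.

(* Testing maximality on the first row [row_mx s%:M r] gives
   [(s^2 + |r|^2)^2 <= s^2 (s^2 + |r|^2)]. *)
Lemma max_corner_row m n (s : R) (r : 'rV[R]_n) (c : 'cV[R]_m)
    (B : 'M[R]_(m, n)) :
  (forall (x : 'rV[R]_(1 + m)) (y : 'rV[R]_(1 + n)),
     ((x *m block_mx s%:M r c B *m y^T) 0 0) ^+ 2 <=
     s ^+ 2 * (x *m x^T) 0 0 * (y *m y^T) 0 0) ->
  r = 0.
Proof.
move=> /(_ (row_mx 1%:M 0) (row_mx s%:M r)).
rewrite mul_row_block !mul1mx !mul0mx !addr0 !tr_row_mx !mul_row_col.
rewrite trmx1 trmx0 tr_scalar_mx mulmx0 mulmx1 addr0 -scalar_mxM.
rewrite !mxE /= !mulr1n mulr1 -expr2.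
have rE : \sum_j r 0 j * r^T j 0 = (r *m r^T) 0 0 by rewrite mxE.
rewrite rE => le_s; apply: sqnorm_eq0.
have := sqnorm_ge0 r; move: le_s; set q := _ 0 0 => le_s q0.
apply/eqP; rewrite eq_le q0 andbT leNgt; apply/negP => q_gt0.
(* [le_s] says exactly that this product is at most [0]. *)
have : 0 < (s ^+ 2 + q) * q by rewrite mulr_gt0// ltr_wpDl ?sqr_ge0.
by move: le_s; rewrite leNgt => /negP; nra.
Qed.

(** The hypothesis is invariant under transposition with [x] and [y] exchanged, so the column case
    is the row case of the transposed block matrix. *)
Lemma max_corner m n (s : R) (r : 'rV[R]_n) (c : 'cV[R]_m)
    (B : 'M[R]_(m, n)) :
  (forall (x : 'rV[R]_(1 + m)) (y : 'rV[R]_(1 + n)),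
     ((x *m block_mx s%:M r c B *m y^T) 0 0) ^+ 2 <=
     s ^+ 2 * (x *m x^T) 0 0 * (y *m y^T) 0 0) ->
  r = 0 /\ c = 0.
Proof.
move=> maxA; split; first exact: max_corner_row maxA.
apply: trmx_inj; rewrite trmx0.
apply: (@max_corner_row _ _ s c^T r^T B^T) => x y.
rewrite -(tr_scalar_mx 1 s) -tr_block_mx.
have -> : x *m (block_mx s%:M r c B)^T *m y^T =
    (y *m block_mx s%:M r c B *m x^T)^T.
  by rewrite !trmx_mul trmxK mulmxA.
by rewrite mxE (le_trans (maxA y x))// mulrAC.
Qed.

Lemma entry_mul_tr m n p q (P : 'M[R]_(m, n)) (A : 'M[R]_(n, p))
    (Q : 'M[R]_(q, p)) i j :
  (row i P *m A *m (row j Q)^T) 0 0 = (P *m A *m Q^T) i j.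
Proof.
rewrite -row_mul mxE [RHS]mxE; apply: eq_bigr => k _.
by rewrite mxE tr_row [(col _ _) _ _]mxE.
Qed.

(** The rows of [P] and [Q] are the new orthonormal bases. The induction on [m] keeps [n] and [A]
    general, since each step removes one row and one column. *)
Lemma svd m n (A : 'M[R]_(m, n)) : (m <= n)%N ->
  exists (P : 'M[R]_m) (Q : 'M[R]_n) (c : 'I_m -> R),
    [/\ P *m P^T = 1%:M, Q *m Q^T = 1%:M, forall i, 0 <= c i,
        forall i j : 'I_m, (i <= j)%N -> c j <= c i &
        forall i j, (P *m A *m Q^T) i j = c i * (i == j :> nat)%:R].
Proof.
elim: m n A => [|m IHm] n A le_mn.
  by exists 1%:M, 1%:M, (fun=> 0); split; rewrite ?trmx1 ?mulmx1//; case.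
case: n le_mn A => // n; rewrite ltnS => le_mn A.
have [s [x [y [s0 x1 y1 Axy maxA]]]] := max_bilinear A.
have [P0 P0P0 P0x] := unit_row_completion (n := m) x1.
have [Q0 Q0Q0 Q0y] := unit_row_completion (n := n) y1.
pose B : 'M[R]_(1 + m, 1 + n) := P0 *m A *m Q0^T.
(* Orthogonal changes of variables preserve norms, so the maximality of [s] passes from [A] to
   [B]. *)
have maxB (x' : 'rV[R]_(1 + m)) (y' : 'rV[R]_(1 + n)) :
    ((x' *m B *m y'^T) 0 0) ^+ 2 <=
    s ^+ 2 * (x' *m x'^T) 0 0 * (y' *m y'^T) 0 0.
  have := maxA (x' *m P0) (y' *m Q0).
  rewrite !trmx_mul !mulmxA -[x' *m P0 *m P0^T]mulmxA P0P0 mulmx1.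
  by rewrite -[y' *m Q0 *m Q0^T]mulmxA Q0Q0 mulmx1.
have BE : B = block_mx s%:M (ursubmx B) (dlsubmx B) (drsubmx B).
  rewrite -[LHS]submxK; congr block_mx; rewrite [LHS]mx11_scalar; congr _%:M.
  by rewrite [LHS]mxE [LHS]mxE !lshift0 -entry_mul_tr P0x Q0y.
have [ur0 dl0] : ursubmx B = 0 /\ dlsubmx B = 0.
  by apply: (max_corner (s := s) (B := drsubmx B)); rewrite -BE.
rewrite {}ur0 {}dl0 in BE.
have [P1 [Q1 [c [P1P1 Q1Q1 c0 c_anti P1BQ1]]]] := IHm n (drsubmx B) le_mn.
(* [c i] is the value of [B] at rows of [P1] and [Q1] padded with a zero, which are still unit
   vectors. This keeps the sequence decreasing when [s] is put in front. *)
have cs i : c i <= s.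
  pose j : 'I_n := widen_ord le_mn i.
  have row1 k (S : 'M[R]_k) l : S *m S^T = 1%:M ->
      (row l S *m (row l S)^T) 0 0 = 1.
    move=> SS; rewrite -[X in (X *m _) 0 0]mulmx1.
    by rewrite entry_mul_tr mulmx1 SS mxE eqxx.
  have := maxB (row_mx 0 (row i P1)) (row_mx 0 (row j Q1)).
  rewrite BE mul_row_block !tr_row_mx !mul_row_col !mul0mx !trmx0 !mulmx0.
  rewrite !add0r !row1// !mulr1.
  have -> : (row i P1 *m drsubmx B *m (row j Q1)^T) 0 0 = c i.
    by rewrite entry_mul_tr P1BQ1 eqxx mulr1.
  by rewrite ler_pXn2r ?nnegrE.
pose c' (i : 'I_(1 + m)) := if split i is inr k then c k else s.
pose bP : 'M[R]_(1 + m) := block_mx 1%:M 0 0 P1.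
pose bQ : 'M[R]_(1 + n) := block_mx 1%:M 0 0 Q1.
have diag (i : 'I_(1 + m)) (j : 'I_(1 + n)) :
    (bP *m B *m bQ^T) i j = c' i * (i == j :> nat)%:R.
  rewrite BE tr_block_mx !mulmx_block !trmx0 trmx1 !mulmx0 !mul0mx !mulmx1.
  rewrite !mul1mx !addr0 !add0r !mul0mx.
  rewrite /c'; case: (splitP i) => i' Ei; case: (splitP j) => j' Ej.
  - have -> : i = lshift _ i' by exact: val_inj.
    have -> : j = lshift _ j' by exact: val_inj.
    by rewrite block_mxEul !ord1 mxE eqxx mulr1.
  - have -> : i = lshift _ i' by exact: val_inj.
    have -> : j = rshift 1 j' by exact: val_inj.
    by rewrite block_mxEur ord1 mxE mulr0.
  - have -> : i = rshift 1 i' by exact: val_inj.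
    have -> : j = lshift _ j' by exact: val_inj.
    by rewrite block_mxEdl ord1 mxE mulr0.
  - have -> : i = rshift 1 i' by exact: val_inj.
    have -> : j = rshift 1 j' by exact: val_inj.
    by rewrite block_mxEdr P1BQ1 /= eqn_add2l.
exists (bP *m P0), (bQ *m Q0), c'; split.
- by apply: orthogonal_mul => //; exact: orthogonal_block.
- by apply: orthogonal_mul => //; exact: orthogonal_block.
- by move=> i; rewrite /c'; case: split.
- move=> i j; rewrite /c'; case: splitP => i' ->; case: splitP => j' -> //=.
    by rewrite ord1.
  by rewrite leq_add2l; exact: c_anti.
move=> i j; rewrite -diag.
have -> // : bP *m P0 *m A *m (bQ *m Q0)^T = bP *m B *m bQ^T.
by rewrite /B trmx_mul !mulmxA.
Qed.

(** Gram-Schmidt as a congruence: if [G] is the Gram matrix of a basis, the rows of [L] hold the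
    coordinates of orthonormal vectors. Clearing the first row and column leaves the Schur
    complement [H'], again symmetric and positive definite. *)
Lemma posdef_orthonormalize n (G : 'M[R]_n) : G^T = G ->
  (forall x : 'rV_n, x != 0 -> 0 < (x *m G *m x^T) 0 0) ->
  exists L : 'M[R]_n, L *m G *m L^T = 1%:M.
Proof.
elim: n G => [|n IHn] G.
  by move=> _ _; exists 0; rewrite [LHS]flatmx0 [RHS]flatmx0.
rewrite -[n.+1]/(1 + n)%N in G * => GT Gpos.
pose g := G 0 0; pose b : 'rV[R]_n := ursubmx G; pose H := drsubmx G.
have GE : G = block_mx g%:M b b^T H.
  rewrite -[LHS]submxK; congr block_mx; last by rewrite /b trmx_ursub GT.
  rewrite [LHS]mx11_scalar; congr _%:M; rewrite !mxE.
  by congr (G _ _); apply: val_inj.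
have g0 : 0 < g.
  have := Gpos (row_mx 1%:M 0 : 'rV[R]_(1 + n)).
  rewrite GE mul_row_block tr_row_mx mul_row_col !mul0mx !mul1mx trmx1 trmx0.
  rewrite mulmx0 mulmx1 !addr0 mxE mulr1n; apply.
  apply/eqP => /(congr1 lsubmx); rewrite row_mxKl linear0 => /rowP /(_ 0) /eqP.
  by rewrite !mxE oner_eq0.
(* one step of symmetric Gaussian elimination *)
pose E : 'M[R]_(1 + n) := block_mx 1%:M 0 (- (g^-1 *: b^T)) 1%:M.
pose H' := H - g^-1 *: (b^T *m b).
have EGE : E *m G *m E^T = block_mx g%:M 0 0 H'.
  rewrite GE /E tr_block_mx !mulmx_block !trmx1 trmx0 !mul1mx !mulmx1 !mul0mx.
  rewrite !mulmx0 !addr0 mul_mx_scalar scalerN scalerA divff ?gt_eqF//.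
  rewrite scale1r addNr mul0mx add0r linearN linearZ /= trmxK mulmxN mul_scalar_mx.
  rewrite scalerA divff ?gt_eqF// scale1r addNr mulNmx -scalemxAl.
  by rewrite (addrC _ H).
have [|y y0|L LHL] := IHn H'.
- by rewrite /H' linearB linearZ /= trmx_mul trmxK /H trmx_drsub GT.
(* The form of [H'] at [y] is that of [G] at [(0, y) E], whose last coordinates are those of [y]. *)
- have yE : row_mx 0 y *m E != 0.
    apply: contra y0 => /eqP /(congr1 rsubmx).
    by rewrite /E mul_row_block row_mxKr mul0mx add0r mulmx1 linear0 => ->.
  have := Gpos _ yE.
  rewrite trmx_mul !mulmxA -(mulmxA _ E) -(mulmxA _ (E *m G)) EGE.
  rewrite mul_row_block tr_row_mx mul_row_col !mul0mx mulmx0 !add0r.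
  by rewrite trmx0 mulmx0 add0r.
(* The pivot [g] is scaled to [1], and the Schur complement is handled by the inductive [L]. *)
pose F : 'M[R]_(1 + n) := block_mx (Num.sqrt g)^-1%:M 0 0 L.
exists (F *m E).
rewrite trmx_mul !mulmxA -(mulmxA _ E) -(mulmxA _ (E *m G)) EGE.
rewrite /F tr_block_mx !mulmx_block !trmx0 !mulmx0 !mul0mx !addr0 !add0r LHL.
rewrite !mul0mx tr_scalar_mx -!scalar_mxM [RHS]scalar_mx_block.
congr (block_mx _%:M _ _ _).
have sg0 : Num.sqrt g != 0 by rewrite gt_eqF ?sqrtr_gt0.
by rewrite -{2}(sqr_sqrtr (ltW g0)); field.
Qed.

End RealMatrices.

(** * Families of vectors and their Gram matrices *)

Section Families.
Variables (R : realType) (W : lmodType R) (ip : {dot W for idfun}).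

Definition mx_family k n (T : 'M[R]_(k, n)) (e : 'I_n -> W) (i : 'I_k) : W :=
  \sum_(j < n) T i j *: e j.

(** By bilinearity, a change of families acts on Gram matrices in the form treated by [svd] and
    [posdef_orthonormalize]. *)
Lemma ip_mx_family k l m n (T : 'M[R]_(k, m)) (S : 'M[R]_(l, n))
    (e : 'I_m -> W) (f : 'I_n -> W) i j :
  ip (mx_family T e i) (mx_family S f j) =
  (T *m (\matrix_(a, b) ip (e a) (f b)) *m S^T) i j.
Proof.
rewrite /mx_family linear_sumr mxE; apply: eq_bigr => b _.
rewrite linearZr_LR linear_sumlz /= !mxE mulrC; congr (_ * _).
by apply: eq_bigr => a _; rewrite linearZl_LR !mxE.
Qed.

Lemma sum_mx_family k n (T : 'M[R]_(k, n)) (e : 'I_n -> W) (a : 'rV[R]_k) :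
  \sum_(i < k) a 0 i *: mx_family T e i = mx_family (a *m T) e 0.
Proof.
under eq_bigr do rewrite scaler_sumr.
rewrite exchange_big; apply: eq_bigr => j _.
rewrite mxE scaler_suml; apply: eq_bigr => i _.
by rewrite scalerA.
Qed.

Lemma mx_family_basis n (U : submodClosed W) (T : 'M[R]_n) (e : 'I_n -> W) :
  T \in unitmx -> is_basis U e -> is_basis U (mx_family T e).
Proof.
move=> uT [eU e_free e_span]; split.
- by move=> i; apply: rpred_sum => j _; apply: rpredZ.
- move=> a a0; pose a' : 'rV[R]_n := \row_i a i.
  have a'T : a' *m T = 0.
    apply/rowP => j; rewrite [RHS]mxE.
    apply: (e_free (fun j => (a' *m T) 0 j)).
    rewrite -[LHS]/(mx_family (a' *m T) e 0) -sum_mx_family -[RHS]a0.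
    by apply: eq_bigr => i _; rewrite mxE.
  move=> i; have := mulmxK uT a'; rewrite a'T mul0mx => /rowP /(_ i).
  by rewrite !mxE => <-.
- move=> x /e_span [a ->]; pose a' : 'rV[R]_n := \row_i a i.
  exists (fun i => (a' *m invmx T) 0 i).
  rewrite sum_mx_family mulmxKV//.
  by apply: eq_bigr => i _; rewrite mxE.
Qed.

Lemma orthonormalize n (U : submodClosed W) (e : 'I_n -> W) : is_basis U e ->
  exists2 e' : 'I_n -> W,
    is_basis U e' & forall i j, ip (e' i) (e' j) = (i == j)%:R.
Proof.
move=> eB; have [_ e_free _] := eB.
pose G : 'M[R]_n := \matrix_(i, j) ip (e i) (e j).
have [||L LGL] := @posdef_orthonormalize R n G.
(* [hermC] carries a sign [(-1) ^+ false] and the conjugation [idfun], both trivial here. *)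
- by apply/matrixP => i j; rewrite !mxE hermC expr0 mul1r.
(* The value is the squared norm of the vector with coordinates [x], which is nonzero by linear
   independence. *)
- move=> x x0; rewrite -ip_mx_family; apply: neq0_dnorm_gt0.
  apply: contra x0 => /eqP ex0; apply/eqP/rowP => j; rewrite mxE.
  exact: e_free ex0 j.
exists (mx_family L e); last by move=> i j; rewrite ip_mx_family LGL mxE.
apply: mx_family_basis => //.
by move: LGL; rewrite -mulmxA => /mulmx1_unit [].
Qed.

(** For unit vectors [|u - v|^2 = 2 - 2 <u, v>]. The case [u = v] is separate because positivity is
    stated for nonzero vectors. *)
Lemma ip_unit_le1 (u v : W) : ip u u = 1 -> ip v v = 1 -> ip u v <= 1.
Proof.
move=> uu vv; have [->|uv] := eqVneq u v; first by rewrite vv.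
have : 0 < ip (u - v) (u - v) by apply: neq0_dnorm_gt0; rewrite subr_eq0.
rewrite linearBl !linearBr /= uu vv (hermC ip v u) expr0 mul1r /=.
by move=> ?; lra.
Qed.

End Families.

Theorem theorem1p1 (R : realType) (W : lmodType R) (ip : {dot W for idfun})
    (K M : nat) (hKM : (K <= M)%N) (U V : submodClosed W)
    (hU : has_dim U K) (hV : has_dim V M) :
  exists (u : 'I_K -> W) (v : 'I_M -> W) (c : 'I_K -> R),
    is_basis U u /\ is_basis V v /\
    (forall i : 'I_K, 0 <= c i <= 1) /\
    (forall i j : 'I_K, (i <= j)%N -> c j <= c i) /\
    (forall i j : 'I_K, ip (u i) (u j) = (i == j)%:R) /\
    (forall i j : 'I_M, ip (v i) (v j) = (i == j)%:R) /\
    (forall (i : 'I_K) (j : 'I_M), ip (u i) (v j) = c i * (i == j :> nat)%:R).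
Proof.
have [e0 e0B] := hU; have [e eB ee] := orthonormalize ip e0B.
have [f0 f0B] := hV; have [f fB ff] := orthonormalize ip f0B.
(* The decomposed matrix holds the scalar products between the two orthonormal bases; the orthogonal
   [P] and [Q] then rotate each basis within its subspace. *)
have [P [Q [c [PP QQ c0 c_anti PAQ]]]] :=
  svd (\matrix_(i, j) ip (e i) (f j)) hKM.
have gram1 n (g : 'I_n -> W) : (forall i j, ip (g i) (g j) = (i == j)%:R) ->
    (\matrix_(i, j) ip (g i) (g j)) = 1%:M.
  by move=> gg; apply/matrixP => i j; rewrite !mxE gg.
have uu i j : ip (mx_family P e i) (mx_family P e j) = (i == j)%:R.
  by rewrite ip_mx_family gram1// mulmx1 PP mxE.
have vv i j : ip (mx_family Q f i) (mx_family Q f j) = (i == j)%:R.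
  by rewrite ip_mx_family gram1// mulmx1 QQ mxE.
have uv i j :
    ip (mx_family P e i) (mx_family Q f j) = c i * (i == j :> nat)%:R.
  by rewrite ip_mx_family PAQ.
exists (mx_family P e), (mx_family Q f), c; split; last split; last split => //.
- by apply: mx_family_basis => //; case: (mulmx1_unit PP).
- by apply: mx_family_basis => //; case: (mulmx1_unit QQ).
move=> i; rewrite c0 /=.
(* [K <= M] provides the partner of index [i] in the second basis, so [c i] is a scalar product of
   unit vectors. *)
have -> : c i = ip (mx_family P e i) (mx_family Q f (widen_ord hKM i)).
  by rewrite uv eqxx mulr1.
by apply: ip_unit_le1; rewrite ?uu ?vv eqxx.
Qed.
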